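(* For every integer $n\geq 3$, the number of spanning quasi-trees of the bouquet $\mathbb{W}^{1}_n$ is $\kappa(\mathbb{W}^{1}_n)=2f_{n+1}-1+(-1)^{n+1}$.
   Context: A bouquet is a ribbon graph (surface with boundary made of vertex discs and edge ribbons) with exactly one vertex. A quasi-tree is a ribbon graph with exactly one boundary component; $\kappa(G)$ is the number of $F\subseteq E(G)$ such that the spanning ribbon subgraph $(V(G),F)$ (delete edges outside $F$) is a quasi-tree. A bouquet with edges $1,\dots,n$ is given by a signed rotation: a cyclic sequence in which each label occurs twice, recording the order in which the edge ends meet the vertex boundary; occurrences may carry a minus sign (plus omitted), and edge $i$ is an orientable loop iff its two occurrences have the same sign, non-orientable otherwise. For $n\geq3$, $\mathbb{W}_n$ has signed rotation $1,n$, followed by $i,i-1$ for $i=2,\dots,n$, i.e. $(1,n,2,1,3,2,4,3,\dots,n,n-1)$, and $\mathbb{W}^{1}_n$ is obtained by adding a half-twist to edge $1$: signed rotation $(-1,n,2,1,3,2,\dots,n,n-1)$. Fibonacci numbers: $f_1=f_2=1$, $f_k=f_{k-1}+f_{k-2}$. *)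

(* Defs.v *)
From mathcomp Require Import all_boot all_order all_algebra zify.
Set Implicit Arguments.
Unset Strict Implicit.
Unset Printing Implicit Defensive.

(* A bouquet given by a signed rotation. The sequence [rotation] is read
   cyclically; an entry [(e, b)] is an occurrence of the label [e], with a
   minus sign when [b = true]. *)
Record bouquet (T : finType) := Bouquet {
  edges : {set T};
  rotation : seq (T * bool);
  rotationP : forall e,
    count (fun x => x.1 == e) rotation = if e \in edges then 2 else 0 }.

Section Bouquets.
Variable T : finType.

(* The ribbon end at position [p] of the rotation meets the vertex boundary in
   an interval with two endpoints: [(p, false)], met first when the boundary is
   traversed in the direction of the rotation, and [(p, true)], met second. *)
Definition corner (G : bouquet T) : finType :=
  ('I_(size (rotation G)) * bool)%type.

Definition occurrence (G : bouquet T) (p : 'I_(size (rotation G))) :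
  T * bool := tnth (in_tuple (rotation G)) p.

(* The arc of the vertex boundary between two cyclically consecutive ribbon
   ends. *)
Definition vertex_arc (G : bouquet T) : rel (corner G) :=
  fun c d => [&& c.2, ~~ d.2 & d.1 == ordS c.1].

(* The two free sides of a ribbon. They join endpoints of opposite kinds when
   the signs of the two occurrences agree (orientable loop), and endpoints of
   the same kind otherwise (non-orientable loop). *)
Definition ribbon_side (G : bouquet T) : rel (corner G) :=
  fun c d => [&& c.1 != d.1,
    (occurrence c.1).1 == (occurrence d.1).1 &
    (c.2 != d.2) == ((occurrence c.1).2 == (occurrence d.1).2)].

Definition boundary_adj (G : bouquet T) : rel (corner G) :=
  fun c d => [|| vertex_arc c d, vertex_arc d c | ribbon_side c d].

(* Without edges the surface is the vertex disc, which has no corner but one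
   boundary circle. *)
Definition boundary_components (G : bouquet T) : nat :=
  if rotation G is [::] then 1 else n_comp (@boundary_adj G) predT.

Definition quasi_tree (G : bouquet T) : bool := boundary_components G == 1.

Fact sub_rotationP (G : bouquet T) (F : {set T}) (e : T) :
  count (fun x => x.1 == e) [seq x <- rotation G | x.1 \in F] =
  if e \in edges G :&: F then 2 else 0.
Proof.
rewrite count_filter inE; case: (boolP (e \in F)) => eF; last first.
  rewrite andbF (@eq_count _ _ pred0) ?count_pred0 // => x /=.
  by case: eqP => //= ->; rewrite (negbTE eF).
rewrite andbT -(rotationP G e); apply: eq_count => x /=.
by case: eqP => //= ->.
Qed.

Definition spanning_sub (G : bouquet T) (F : {set T}) : bouquet T :=
  Bouquet (sub_rotationP G F).

Definition kappa (G : bouquet T) : nat :=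
  #|[set F : {set T} | (F \subset edges G) && quasi_tree (spanning_sub G F)]|.

End Bouquets.

(* The labels 1, ..., n are the nonzero elements of ['I_n.+1]. *)
Definition W1_rotation (n : nat) : seq ('I_n.+1 * bool) :=
  (inord 1, true) ::
  [seq (inord k, false)
     | k <- n :: flatten [seq [:: i; i.-1] | i <- iota 2 n.-1]].

Fact W1_rotationP (n : nat) (hn : 3 <= n) (e : 'I_n.+1) :
  count (fun x => x.1 == e) (W1_rotation n) =
  if e \in [set i : 'I_n.+1 | 0 < i] then 2 else 0.
Proof.
have inordE k : k <= n -> (inord k == e :> 'I_n.+1) = (k == e).
  by move=> kn; rewrite -val_eqE /= inordK.
rewrite /W1_rotation /= !inordE; [|lia|lia].
rewrite count_map.
have -> : forall s, all (fun i => i <= n) s ->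
    count (preim (fun k => (inord k, false)) (fun x => x.1 == e))
      (flatten [seq [:: i; i.-1] | i <- s]) =
    count_mem (e : nat) s + count_mem (e : nat) (map predn s).
- elim=> //= i s IHs /andP[i_le s_le]; rewrite IHs //= !inordE ?addnA; [|lia|lia].
  by rewrite -!addnA; congr (_ + _); rewrite addnCA.
- have -> : [seq i.-1 | i <- iota 2 n.-1] = iota 1 n.-1.
    by rewrite (iotaDl 1 1) -map_comp map_id_in.
  rewrite !count_uniq_mem ?iota_uniq // !mem_iota inE.
  by move: (nat_of_ord e) (ltn_ord e) => [|[|k]] k_lt //=; lia.
by apply/allP => i; rewrite mem_iota; lia.
Qed.

Definition W1 (n : nat) (hn : 3 <= n) : bouquet 'I_n.+1 :=
  Bouquet (W1_rotationP hn).

Fixpoint fib (k : nat) : nat :=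
  match k with
  | 0 => 0
  | k'.+1 => if k' is k''.+1 then fib k' + fib k'' else 1
  end.

(* Main.v *)
(* Over the field with two elements, a function on the corners of a bouquet
   which is constant along the boundary is determined, up to a constant, by the
   set of edges at whose ends it changes, and the sets so obtained are the
   vectors of the kernel of the interlacement matrix with a diagonal entry 1 for
   each non-orientable loop. Hence a bouquet is a quasi-tree iff this matrix is
   invertible. The interlacement graph of W^1_n is the cycle 1, ..., n with a
   loop at 1, so an edge set F containing 1 (resp. not containing 1) is a
   quasi-tree iff the runs of F on the path 2, ..., n are all even, except
   possibly one of the two runs touching the ends (resp. are all even); a single
   run covering the whole path must be even. These words are counted by linear
   recurrences of Fibonacci type. *)
Require Import Defs.
From mathcomp Require Import all_boot all_order all_algebra zify.
Set Implicit Arguments.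
Unset Strict Implicit.
Unset Printing Implicit Defensive.

(** * Connectedness tested by invariant Boolean functions *)

Section ConnectedGraph.
Variables (T : finType) (e : rel T).
Hypothesis e_sym : symmetric e.

(** An invariant function with both values splits the graph into two nonempty closed sets, each
    containing a component. Conversely, [connect e x0] is itself invariant, so if it is constant
    every point lies in the component of [x0]. *)
Lemma n_comp_eq1P (x0 : T) :
  reflect (forall c : T -> bool, (forall x y, e x y -> c x = c y) ->
             forall x y, c x = c y)
          (n_comp e predT == 1).
Proof.
have cs : connect_sym e by apply: sym_connect_sym.
apply: (iffP eqP) => [n1 c cinv x y | cst]; last first.
  have cinv u v : e u v -> connect e x0 u = connect e x0 v.
    move=> euv; have cuv := connect1 euv.
    by apply/idP/idP => /connect_trans; apply; rewrite // cs.
  rewrite -(n_comp_connect cs x0); apply: eq_n_comp_r => y.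
  by rewrite !inE (cst _ cinv y x0) connect0.
have n_comp_gt0 (a : pred T) z : closed e a -> z \in a -> 0 < n_comp e a.
  move=> cla az; apply/card_gt0P; exists (fingraph.root e z).
  by rewrite !inE roots_root //= -(closed_connect cla (connect_root e z)).
have clc : closed e c by move=> u v /cinv; rewrite /in_mem /= => ->.
have clC : closed e [predC c] by apply: predC_closed.
have no_split u v : c u -> c v.
  move=> cu; apply/negPn/negP => ncv.
  have := n_comp_gt0 c u clc cu; have := n_comp_gt0 [predC c] v clC ncv.
  have := n_compC c e; rewrite n1.
  by case: (n_comp _ _) => // k; case: (n_comp _ _) => // l; rewrite addSn addnS.
by apply/idP/idP; apply: no_split.
Qed.

End ConnectedGraph.

(** * Parities along a rotation and the kernel condition *)

Section BoundaryKernel.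
Variable T : finType.
Implicit Types (r A B C : seq (T * bool)) (a : T * bool) (X F : {set T}).

Definition parity X r := odd (count (fun a => a.1 \in X) r).

Lemma parity_cat X r1 r2 : parity X (r1 ++ r2) = parity X r1 (+) parity X r2.
Proof. by rewrite /parity count_cat oddD. Qed.

Lemma parity_cons X a r : parity X (a :: r) = (a.1 \in X) (+) parity X r.
Proof. by rewrite /parity /= oddD oddb. Qed.

(* The indicator of [X] is in the kernel, over the field with two elements, of
   the interlacement matrix whose diagonal marks the non-orientable loops,
   as far as the rows indexed by [F] are concerned. *)
Definition in_kernel r F X := forall A a B a' C,
  r = A ++ a :: B ++ a' :: C -> a.1 = a'.1 -> a.1 \in F ->
  parity X B = (a.2 != a'.2) && (a.1 \in X).

Lemma filter_eq_cat_cons (S : Type) (p : pred S) (s s1 s2 : seq S) x :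
  filter p s = s1 ++ x :: s2 ->
  exists t1 t2, [/\ s = t1 ++ x :: t2, filter p t1 = s1 & filter p t2 = s2].
Proof.
elim: s s1 => [|y s IHs] s1 /=; first by case: s1.
case: ifP => py; last first.
  by move=> /IHs[t1 [t2 [-> <- <-]]]; exists (y :: t1), t2; rewrite /= py.
case: s1 => [[-> <-]|z s1 [<-]]; first by exists [::], s.
by move=> /IHs[t1 [t2 [-> <- <-]]]; exists (y :: t1), t2; rewrite /= py.
Qed.

Lemma in_kernel_filter r F X : X \subset F ->
  in_kernel [seq x <- r | x.1 \in F] setT X <-> in_kernel r F X.
Proof.
move=> /subsetP sXF.
have parity_filter B : parity X [seq x <- B | x.1 \in F] = parity X B.
  rewrite /parity count_filter; congr odd; apply: eq_count => x /=.
  by case: (boolP (x.1 \in X)) => // /sXF ->.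
split=> kerX A a B a' C.
  move=> Er Ea aF; rewrite -parity_filter.
  apply: (kerX [seq x <- A | x.1 \in F] a _ a' [seq x <- C | x.1 \in F]) => //.
  by rewrite Er filter_cat /= aF filter_cat /= -Ea aF.
move=> Ef Ea _; have [A1 [R1 [Er EA ER]]] := filter_eq_cat_cons Ef.
have [B1 [C1 [ER' EB EC]]] := filter_eq_cat_cons ER.
rewrite -EB parity_filter; apply: (kerX A1 a B1 a' C1) => //.
  by rewrite Er ER'.
have: a \in [seq x <- r | x.1 \in F] by rewrite Ef mem_cat inE eqxx orbT.
by rewrite mem_filter => /andP[].
Qed.

Lemma eq_first_occurrence r r' A A' (a a' : T * bool) (e : T) :
    A ++ a :: r = A' ++ a' :: r' -> a.1 = e -> a'.1 = e ->
    count (fun x => x.1 == e) A = 0 -> count (fun x => x.1 == e) A' = 0 ->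
  [/\ A = A', a = a' & r = r'].
Proof.
move=> + ae a'e; elim: A A' => [|x A IHA] [|x' A'] /=.
- by case=> -> ->.
- by case=> <- _ _; rewrite ae eqxx.
- by case=> -> _; rewrite a'e eqxx.
by case=> -> /IHA{}IHA /eqP; rewrite addn_eq0 => /andP[_ /eqP cA] /eqP;
  rewrite addn_eq0 => /andP[_ /eqP cA']; have [-> -> ->] := IHA cA cA'.
Qed.

(** With exactly two occurrences of [e] the splitting at them is unique, so [in_kernel] amounts to
    one equation per edge. *)
Lemma eq_two_occurrences A B C A' B' C' (a b a' b' : T * bool) (e : T) :
    A ++ a :: B ++ b :: C = A' ++ a' :: B' ++ b' :: C' ->
    count (fun x => x.1 == e) (A ++ a :: B ++ b :: C) = 2 ->
    a.1 = e -> b.1 = e -> a'.1 = e -> b'.1 = e ->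
  [/\ a = a', B = B' & b = b'].
Proof.
move=> E c2 ae be a'e b'e; have c2' := c2; rewrite E in c2'.
move: c2 c2'; rewrite !count_cat /= !count_cat /=.
rewrite ae be a'e b'e eqxx => c2 c2'.
pose m s := count (fun x : T * bool => x.1 == e) s.
have [mA mA' mB mB'] : [/\ m A = 0, m A' = 0, m B = 0 & m B' = 0].
  by rewrite /m; split; lia.
have [_ -> E2] := eq_first_occurrence E ae a'e mA mA'.
by have [-> -> _] := eq_first_occurrence E2 be b'e mB mB'.
Qed.


Lemma parity_sum_even X r :
  (forall e, e \in X -> ~~ odd (count (fun x => x.1 == e) r)) ->
  parity X r = false.
Proof.
have -> : parity X r = odd (\sum_(e in X) count (fun x => x.1 == e) r).
  rewrite /parity; congr odd; elim: r => [|a r IHr] /=.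
    by rewrite big1.
  rewrite IHr big_split /=; congr (_ + _).
  have [aX|aX] := boolP (a.1 \in X).
    rewrite (bigD1 _ aX) /= eqxx big1 // => e /andP[_ /negbTE].
    by rewrite eq_sym => ->.
  by rewrite big1 // => e eX; case: eqP aX => // ->; rewrite eX.
move=> even_r; apply/negbTE; apply: (big_ind (fun k => ~~ odd k)) => //.
by move=> k l; rewrite oddD => /negbTE -> /negbTE ->.
Qed.

Lemma take_split_at (S : Type) (x0 : S) (s : seq S) p q : p < q <= size s ->
  take q s = take p s ++ nth x0 s p :: drop p.+1 (take q s).
Proof.
move=> /andP[pq qs]; rewrite -{1}(cat_take_drop p (take q s)).
rewrite take_takel ?(ltnW pq) // (drop_nth x0) ?nth_take //.
by rewrite size_takel.
Qed.

Lemma split_at_two (S : Type) (x0 : S) (s : seq S) p q : p < q < size s ->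
  s = take p s ++ nth x0 s p :: drop p.+1 (take q s) ++
        nth x0 s q :: drop q.+1 s.
Proof.
move=> /andP[pq qs]; rewrite -drop_nth // -cat_cons catA -take_split_at.
  by rewrite cat_take_drop.
by rewrite pq ltnW.
Qed.

End BoundaryKernel.

(** * Trivial kernel as a criterion for quasi-trees *)

Section QuasiTreeKernel.
Variables (T : finType) (G : bouquet T).
Let r := rotation G.
Implicit Types (c d : corner G) (X : {set T}).

Lemma ribbon_side_sym : symmetric (@ribbon_side T G).
Proof.
move=> c d; rewrite /ribbon_side [c.1 == _]eq_sym [c.2 == _]eq_sym.
by rewrite [(occurrence c.1).1 == _]eq_sym [(occurrence c.1).2 == _]eq_sym.
Qed.

Lemma boundary_adj_sym : symmetric (@boundary_adj T G).
Proof. by move=> c d; rewrite /boundary_adj orbCA ribbon_side_sym. Qed.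

(** The Boolean [c.2] counts as 0 or 1: at its second endpoint a ribbon end has itself been
    passed. *)
Definition corner_parity X c := parity X (take (c.1 + c.2) r).

Lemma corner_parity_true X p :
  corner_parity X (p, true) =
  corner_parity X (p, false) (+) ((occurrence p).1 \in X).
Proof.
rewrite /corner_parity /= addn1 addn0 /occurrence.
set a := tnth _ _; have -> : a = nth a r p by exact: (tnth_nth a (in_tuple r) p).
by rewrite (take_nth a) // -cats1 parity_cat parity_cons addbF.
Qed.

(** Let [B] lie between the ends [p < q] of an edge. With equal signs a side joins [(p, true)] to
    [(q, false)], so [B] has even parity; with opposite signs it joins [(p, false)] to [(q, false)],
    so the parity is that of the edge itself. The other side gives the same equation. *)
Lemma ribbon_parityP X :
  (forall c d, ribbon_side c d -> corner_parity X c = corner_parity X d) <->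
  in_kernel r setT X.
Proof.
split=> [inv A a B a' C Er Ea _ | kerX].
  have ltp : size A < size r by rewrite Er size_cat /=; lia.
  have ltq : size A + (size B).+1 < size r.
    by rewrite Er !size_cat /= size_cat /=; lia.
  pose p : 'I_(size (rotation G)) := Ordinal ltp.
  pose q : 'I_(size (rotation G)) := Ordinal ltq.
  have op : occurrence p = a.
    by rewrite /occurrence (tnth_nth a) /= -/r Er nth_cat ltnn subnn.
  have oq : occurrence q = a'.
    rewrite /occurrence (tnth_nth a) /= -/r Er nth_cat ltnNge leq_addr /=.
    by rewrite addKn /= nth_cat ltnn subnn.
  have Pp : corner_parity X (p, false) = parity X A.
    by rewrite /corner_parity /= addn0 Er take_size_cat.
  have Pq : corner_parity X (q, false) =
      parity X A (+) (a'.1 \in X) (+) parity X B.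
    rewrite /corner_parity /= addn0 Er -cat_cons catA take_size_cat.
      by rewrite parity_cat parity_cons addbA Ea.
    by rewrite size_cat.
  have npq : p != q by rewrite -val_eqE /=; lia.
  have := inv (p, a.2 == a'.2) (q, false).
  rewrite /ribbon_side /= npq op oq Ea eqxx /=.
  case: (a.2 == a'.2) => /= /(_ isT); rewrite ?corner_parity_true ?op Pp Pq ?Ea.
    by case: (_ \in _); case: (parity X A); case: (parity X B).
  by case: (_ \in _); case: (parity X A); case: (parity X B).
have inv (p q : 'I_(size (rotation G))) b b' : p < q ->
    ribbon_side ((p, b) : corner G) (q, b') ->
    corner_parity X (p, b) = corner_parity X (q, b').
  move=> ltpq /and3P[_ /= /eqP Ea].
  have x0 := occurrence p.
  have ltqr : p < q < size r by rewrite ltpq /= ltn_ord.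
  have Er := split_at_two x0 ltqr.
  have op : nth x0 r p = occurrence p by rewrite /occurrence (tnth_nth x0).
  have oq : nth x0 r q = occurrence q by rewrite /occurrence (tnth_nth x0).
  have Eq : take q r = take p r ++ nth x0 r p :: drop p.+1 (take q r).
    by apply: take_split_at; rewrite ltpq ltnW.
  have := kerX _ _ _ _ _ Er; rewrite op oq Ea inE => /(_ erefl isT).
  have : corner_parity X (q, false) =
     corner_parity X (p, false) (+) ((occurrence q).1 \in X)
       (+) parity X (drop p.+1 (take q r)).
    by rewrite /corner_parity /= !addn0 {1}Eq parity_cat parity_cons op Ea addbA.
  have := corner_parity_true X p; have := corner_parity_true X q; rewrite Ea.
  move: (parity _ _) => d Eqt Ept Eqf Ed.
  case: b b' => [] []; rewrite ?Ept ?Eqt Eqf Ed; case: (_.2 == _.2) => //= _;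
    by case: (corner_parity _ _); case: (_ \in _).
move=> [p b] [q b'] adj; case: (ltngtP p q) => [ltpq|ltqp|Epq].
- exact: inv.
- by apply/esym/inv => //; rewrite ribbon_side_sym.
- by move: adj; rewrite /ribbon_side /= (val_inj Epq) eqxx.
Qed.

Lemma parity_rotation X : X \subset edges G -> parity X r = false.
Proof.
move=> /subsetP sXG; apply: parity_sum_even => e /sXG eG.
by rewrite rotationP eG.
Qed.

Lemma edge_occurs e :
  e \in edges G -> exists p : 'I_(size r), (occurrence p).1 = e.
Proof.
move=> eG; have /(has_nthP (e, false))[i ltir /eqP Ei] :
    has (fun x => x.1 == e) r by rewrite has_count rotationP eG.
by exists (Ordinal ltir); rewrite /occurrence (tnth_nth (e, false)).
Qed.

Lemma occurrence_edge (p : 'I_(size r)) : (occurrence p).1 \in edges G.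
Proof.
have : has (fun x => x.1 == (occurrence p).1) r.
  by apply/hasP; exists (occurrence p) => //; apply: mem_tnth.
by rewrite has_count rotationP; case: ifP.
Qed.

(* A function constant along the boundary is, up to a constant, the prefix
   parity of the set of the edges at whose ends it changes. *)
Lemma boundary_invariant_parity (c : corner G -> bool) :
    (forall x y, boundary_adj x y -> c x = c y) ->
  exists (b : bool) (X : {set T}),
    X \subset edges G /\ forall x, c x = b (+) corner_parity X x.
Proof.
move=> inv.
pose X := [set e | [exists p : 'I_(size r),
  ((occurrence p).1 == e) && (c (p, true) != c (p, false))]].
have change p : c (p, true) = c (p, false) (+) ((occurrence p).1 \in X).
  have -> : ((occurrence p).1 \in X) = (c (p, true) != c (p, false)).
    rewrite inE; apply/existsP/idP => [[q /andP[/eqP Eqp cq]]|cp]; last first.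
      by exists p; rewrite eqxx.
    (* The two sides of the ribbon carry both values of [c] to the other end, possibly swapped, so
       [c] changes at both ends or at neither. *)
    have [<- //|npq] := eqVneq q p.
    pose s := (occurrence q).2 == (occurrence p).2.
    have side b : c (q, b) = c (p, b (+) s).
      apply: inv; rewrite /boundary_adj /ribbon_side /= npq Eqp eqxx /= -/s.
      by case: b; case: (s); rewrite ?orbT.
    by move: cq; rewrite !side; case: (s) => //=; rewrite eq_sym.
  by case: (c (p, true)); case: (c (p, false)).
have XG : X \subset edges G.
  apply/subsetP => e; rewrite inE => /existsP[p /andP[/eqP <- _]].
  exact: occurrence_edge.
case: (posnP (size r)) => [r0|r_gt0].
  by exists true, X; split=> // -[[p ltp]]; exfalso; move: ltp; rewrite -/r r0.
pose o : 'I_(size (rotation G)) := Ordinal r_gt0.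
exists (c (o, false)), X; split=> //.
have cF k (ltk : k < size r) :
    c (Ordinal ltk, false) = c (o, false) (+) corner_parity X (Ordinal ltk, false).
  elim: k ltk => [|k IHk] ltk.
    by rewrite /corner_parity /= take0 addbF; congr (c (_, _)); apply: val_inj.
  have ltk' := ltnW ltk.
  have <- : c (Ordinal ltk', true) = c (Ordinal ltk, false).
    apply: inv; rewrite /boundary_adj /vertex_arc /=.
    by rewrite -val_eqE /= modn_small // eqxx.
  rewrite change IHk -addbA -corner_parity_true; congr (_ (+) _).
  by rewrite /corner_parity /= addn1 addn0.
by move=> [[p ltp] []]; rewrite ?change cF -?addbA -?corner_parity_true.
Qed.

Lemma quasi_treeP :
  reflect (forall X, X \subset edges G -> in_kernel r setT X -> X = set0)
          (quasi_tree G).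
Proof.
case: (posnP (size r)) => [r0|r_gt0].
  have -> : quasi_tree G.
    by rewrite /quasi_tree /boundary_components; move: r0;
      rewrite /r; case: rotation.
  apply: ReflectT => X /subsetP sXG _; apply/setP => e; rewrite inE.
  by apply/negP => /sXG /edge_occurs[[p ltp] _]; move: ltp; rewrite r0.
have -> : quasi_tree G = (n_comp (@boundary_adj T G) predT == 1).
  by rewrite /quasi_tree /boundary_components; move: r_gt0;
    rewrite /r; case: rotation.
pose o : 'I_(size (rotation G)) := Ordinal r_gt0.
apply: (iffP (n_comp_eq1P boundary_adj_sym (o, false)))
  => [cst X XG kerX | ker0 c inv].
  have arc c d : vertex_arc c d -> corner_parity X c = corner_parity X d.
    case: c d => [p b] [q b'] /and3P[/= -> /negbTE -> /eqP ->].
    rewrite /corner_parity /= addn1 addn0.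
    have [ltp|] := ltnP p.+1 (size r); first by rewrite modn_small.
    (* The last arc returns to position 0, where the prefix is empty; the parities match because
       each edge of [X] occurs twice. *)
    rewrite leq_eqVlt ltnS leqNgt ltn_ord orbF => /eqP Ep.
    by rewrite -Ep modnn take0 take_size parity_rotation.
  have inv c d : boundary_adj c d -> corner_parity X c = corner_parity X d.
    case/or3P => [/arc //|/arc //|]; exact: (ribbon_parityP X).2.
  apply/setP => e; rewrite inE; apply/negP => eX.
  have [p Ep] := edge_occurs (subsetP XG _ eX).
  have := corner_parity_true X p; rewrite Ep eX.
  by rewrite (cst _ inv (p, true) (p, false)); case: corner_parity.
have [b [X [XG cE]]] := boundary_invariant_parity inv.
have X0 : X = set0.
  apply: ker0 => //; apply/ribbon_parityP => x y xy.
  by apply: (can_inj (addKb b)); rewrite -!cE; apply: inv;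
    rewrite /boundary_adj xy !orbT.
move=> x y; rewrite !cE X0; congr (_ (+) _).
have par0 s : parity (set0 : {set T}) s = false.
  by rewrite /parity (eq_count (a2 := pred0)) ?count_pred0 // => z; rewrite inE.
by rewrite /corner_parity !par0.
Qed.

End QuasiTreeKernel.

Lemma quasi_tree_subP (T : finType) (G : bouquet T) (F : {set T}) :
    F \subset edges G ->
  reflect (forall X : {set T},
             X \subset F -> in_kernel (rotation G) F X -> X = set0)
          (quasi_tree (spanning_sub G F)).
Proof.
move=> /setIidPr FG.
apply: (iffP (quasi_treeP _)); rewrite /= FG => ker0 X XF kerX.
  by apply: ker0 => //; apply/in_kernel_filter.
by apply: ker0 => //; apply/in_kernel_filter.
Qed.

(** * The cyclic linear system and its propagation along a path *)

Section CyclicSystem.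

Definition cpred n i := if i == 1 then n else i.-1.
Definition csucc n i := if i == n then 1 else i.+1.

Lemma cpred_bounds n i : 0 < i <= n -> 0 < cpred n i <= n.
Proof. by rewrite /cpred; case: eqP; lia. Qed.

Lemma csucc_bounds n i : 0 < i <= n -> 0 < csucc n i <= n.
Proof. by rewrite /csucc; case: eqP; lia. Qed.

(** Apart from labels met twice, only the two cyclic neighbours of [i] lie between its ends. The
    signs differ only for the half-twisted edge 1. *)
Lemma W1_rotation_split n i : 3 <= n -> 0 < i <= n ->
  exists A B C s s',
  [/\ W1_rotation n = A ++ (inord i, s) :: B ++ (inord i, s') :: C,
      (s != s') = (i == 1) &
      forall X : {set 'I_n.+1}, parity X B =
        (inord (cpred n i) \in X) (+) (inord (csucc n i) \in X)].
Proof.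
move=> n3 /andP[i_gt0 le_in]; rewrite /cpred /csucc /W1_rotation.
pose lab k : 'I_n.+1 * bool := (inord k, false).
have [->|i_neq1] := eqVneq i 1.
  have -> : n.-1 = n.-2.+1 by lia.
  exists [::], [:: lab n; lab 2].
  exists (map lab (flatten [seq [:: i; i.-1] | i <- iota 3 n.-2])).
  exists true, false; split=> // X; rewrite !parity_cons addbF.
  by case: (1 =P n) => //; lia.
have [->|i_neqn] := eqVneq i n.
  have -> : iota 2 n.-1 = iota 2 (n - 2) ++ [:: n].
    have -> : n.-1 = (n - 2) + 1 by lia.
    by rewrite iotaD; have -> : 2 + (n - 2) = n by lia.
  exists [:: (inord 1, true)].
  exists (map lab (flatten [seq [:: i; i.-1] | i <- iota 2 (n - 2)])).
  exists [:: lab n.-1], false, false; split.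
  - by rewrite map_cat flatten_cat /= map_cat.
  - by [].
  (* The blocks [i, i-1] telescope modulo 2. *)
  have par m X : parity X (map lab (flatten [seq [:: i; i.-1] | i <- iota 2 m])) =
      (inord 1 \in X) (+) (inord m.+1 \in X).
    elim: m => [|m IHm]; first by rewrite addbb.
    have -> : iota 2 m.+1 = iota 2 m ++ [:: m.+2].
      by rewrite -[in LHS](addn1 m) iotaD add2n.
    rewrite map_cat flatten_cat map_cat parity_cat IHm !parity_cons /= addbF.
    by rewrite -!addbA; congr (_ (+) _); rewrite [X in _ (+) X]addbC addKb.
  by move=> X; rewrite par addbC; have -> : (n - 2).+1 = n.-1 by lia.
have -> : iota 2 n.-1 = iota 2 i.-2 ++ [:: i, i.+1 & iota i.+2 (n - i.+1)].
  have -> : n.-1 = i.-2 + (n - i.+1).+2 by lia.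
  by rewrite iotaD; have -> : 2 + i.-2 = i by lia.
exists ((inord 1, true) :: lab n ::
  map lab (flatten [seq [:: i; i.-1] | i <- iota 2 i.-2])).
exists [:: lab i.-1; lab i.+1].
exists (map lab (flatten [seq [:: i; i.-1] | i <- iota i.+2 (n - i.+1)])).
exists false, false.
split=> [||X].
- by rewrite map_cat flatten_cat /= map_cat.
- by [].
- by rewrite !parity_cons addbF.
Qed.

Lemma in_kernel_W1 n (n3 : 3 <= n) (F X : {set 'I_n.+1}) :
    F \subset edges (W1 n3) ->
  in_kernel (W1_rotation n) F X <->
  forall i, 0 < i <= n -> inord i \in F ->
    (inord (cpred n i) \in X) (+) (inord (csucc n i) \in X) =
    (i == 1) && (inord i \in X).
Proof.
move=> /subsetP sFG; split=> [kerX i i_bd iF | rowX A a B a' C Er Ea aF].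
  have [A [B [C [s [s' [Er <- <-]]]]]] := W1_rotation_split n3 i_bd.
  exact: kerX Er erefl iF.
have a_gt0 : 0 < a.1 by have := sFG _ aF; rewrite inE.
have a_bd : 0 < a.1 <= n by rewrite a_gt0 -ltnS ltn_ord.
have [A1 [B1 [C1 [s [s' [Er1 Es EB]]]]]] := W1_rotation_split n3 a_bd.
rewrite inord_val in Er1.
have two : count (fun x : 'I_n.+1 * bool => x.1 == a.1)
    (A ++ a :: B ++ a' :: C) = 2.
  by rewrite -Er (W1_rotationP n3) inE a_gt0.
have E : A ++ a :: B ++ a' :: C = A1 ++ (a.1, s) :: B1 ++ (a.1, s') :: C1.
  by rewrite -Er.
have [-> -> ->] := eq_two_occurrences E two erefl (esym Ea) erefl erefl.
by rewrite EB Es /=; have := rowX _ a_bd; rewrite inord_val; apply.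
Qed.

(** At a vertex of the edge set the kernel equation makes the neighbours agree; at any other vertex
    the support condition forces zero. *)
Definition row (b x : nat -> bool) j := if b j then x j.-1 == x j.+1 else ~~ x j.

(* [solvable b1 x1 x2 s u w nz] decides whether the values [u], [w] at two
   consecutive vertices extend along the word [s] to a solution closing up at
   vertex 1, where the solution has values [x1], [x2] at vertices 1 and 2;
   [nz] records that a nonzero value has been met. *)
Fixpoint solvable (b1 x1 x2 : bool) (s : seq bool) (u w nz : bool) : bool :=
  match s with
  | [::] => [&& nz, w == x1 & b1 ==> (u (+) x2 == x1)]
  | true :: s' => solvable b1 x1 x2 s' w u nz
  | false :: s' => ~~ w && (solvable b1 x1 x2 s' false false nz
                            || solvable b1 x1 x2 s' false true true)
  end.

(** A letter [true] forces the next value to repeat [u]; a letter [false] requires [w] to be zero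
    and leaves the next value free. The conditions on [nz] keep the flag consistent with [u] and
    [w]. *)
Lemma solvableP (b1 x1 x2 : bool) (b : nat -> bool) i k (u w nz : bool) :
  0 < i ->
    (w -> nz) -> (u -> nz) ->
  solvable b1 x1 x2 [seq b j | j <- iota i k] u w nz <->
  exists x : nat -> bool,
    [/\ x i.-1 = u, x i = w, forall j, i <= j < i + k -> row b x j,
        x (i + k) = x1 /\ (b1 -> x (i + k).-1 (+) x2 = x1) &
        nz \/ exists2 j, i < j <= i + k & x j].
Proof.
elim: k i u w nz => [|k IHk] i u w nz i_gt0.
  have neq_pred : (i.-1 == i) = false by lia.
  rewrite addn0; split=> [/and3P[nzT /eqP wx1 /implyP end1]|].
    exists (fun j => if j == i then w else u); rewrite eqxx neq_pred.
    split=> //; [|by split=> // /end1/eqP|by left].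
    by move=> j /andP[/leq_ltn_trans h /h]; rewrite ltnn.
  case=> x [<- <- _ [-> end1] nzx] /=; rewrite eqxx /=.
  have -> /= : nz.
    by case: nzx => // -[j /andP[/leq_trans h /h]]; rewrite ltnn.
  by apply/implyP => /end1 ->.
have neq1 : (i.+1 == i) = false by rewrite gtn_eqF.
have neq_pred j : i <= j -> (j == i.-1) = false by lia.
have addE : i + k.+1 = i.+1 + k by rewrite addnS.
move=> wnz unz; have step :
    solvable b1 x1 x2 [seq b j | j <- iota i k.+1] u w nz <->
    exists v, (if b i then u == v else ~~ w) /\
      solvable b1 x1 x2 [seq b j | j <- iota i.+1 k] w v (nz || v).
  rewrite /=; case: (b i).
    split=> [sol|[v [/eqP <-]]]; last by case: (u) unz => [->|]; rewrite ?orbF.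
    by exists u; rewrite eqxx; split=> //; case: (u) unz sol => [->|]; rewrite ?orbF.
  split=> [/andP[/negbTE -> /orP[] sol]|[v [/negbTE -> /= sol]]].
  - by exists false; rewrite orbF.
  - by exists true; rewrite orbT.
  - by case: v sol; rewrite ?orbT ?orbF => ->; rewrite ?orbT.
rewrite step; split=> [[v [rowi]]|].
  have H1 : w -> nz || v by move=> /wnz ->.
  have H2 : v -> nz || v by move=> ->; rewrite orbT.
  move=> /(IHk i.+1 w v _ isT H2 H1)[x [/= xi xi1 rowx [endx endb] nzx]].
  (* The inductive solution is only prescribed from index [i] on, so [u] may be written at
     [i.-1]. *)
  exists (fun j => if j == i.-1 then u else x j).
  rewrite eqxx neq_pred // addE; split=> //.
  - move=> j /andP[]; rewrite leq_eqVlt => /predU1P[<- _|ltij ltjk].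
      by rewrite /row eqxx !neq_pred // xi xi1.
    have leij := ltnW ltij; have leij1 := leqW leij.
    have leji : i <= j.-1 by case: (j) ltij.
    by have := rowx j; rewrite ltij ltjk /row !neq_pred //; exact.
  - have le1 : i <= i.+1 + k by rewrite -addE leq_addr.
    have le2 : i <= (i.+1 + k).-1 by rewrite -addE addnS leq_addr.
    by rewrite !neq_pred.
  - case: nzx => [/orP[|vT]|[j /andP[ltij ltjk] xj]]; first by left.
      by right; exists i.+1; rewrite ?neq_pred ?xi1 // ltnSn leq_addr.
    have leij := ltnW ltij.
    by right; exists j; [rewrite leij|rewrite neq_pred // ltnW].
case=> x [xu xw rowx [endx endb] nzx].
exists (x i.+1); split.
  have := rowx i; rewrite leqnn addE ltnS leq_addr /row xu xw; exact.
apply/IHk => //.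
- by move=> ->; rewrite orbT.
- by move=> /wnz ->.
exists x; split=> //; rewrite -?addE //.
- by move=> j /andP[ltij ltjk]; apply: rowx; rewrite ltnW.
- case: nzx => [->|[j /andP[ltij ltjk] xj]]; first by left.
  move: ltij; rewrite leq_eqVlt => /predU1P[Ej|ltij].
    by left; rewrite Ej xj orbT.
  by right; exists j => //; rewrite ltij.
Qed.

End CyclicSystem.

(** * Solvability read off from run parities *)

Section Automaton.

Definition some2 (f : bool -> bool -> bool) :=
  [|| f false false, f false true, f true false | f true true].

Lemma some2P (f : bool -> bool -> bool) : reflect (exists x y, f x y) (some2 f).
Proof.
apply: (iffP idP) => [|[x [y]]]; last first.
  by rewrite /some2; case: x y => -[] ->; rewrite ?orbT.
by case/or4P => h;
  [exists false, false|exists false, true|exists true, false|exists true, true].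
Qed.

(* In the three automata below the first argument is the parity of the length
   of the current run of [true]. *)
Fixpoint even_runs p s :=
  match s with
  | [::] => ~~ p
  | true :: s' => even_runs (~~ p) s'
  | false :: s' => ~~ p && even_runs false s'
  end.

Fixpoint even_runs_but_last p s :=
  match s with
  | [::] => true
  | true :: s' => even_runs_but_last (~~ p) s'
  | false :: s' => ~~ p && even_runs_but_last false s'
  end.

(* All runs are even, except possibly one of the first and the last. *)
Fixpoint even_runs_but_end p s :=
  match s with
  | [::] => ~~ p
  | true :: s' => even_runs_but_end (~~ p) s'
  | false :: s' => if p then even_runs false s' else even_runs_but_last false s'
  end.

Definition accepted b1 s :=
  if b1 then even_runs_but_end false s else even_runs false s.

Lemma solvable_zero b1 s : solvable b1 false false s false false true.
Proof. by elim: s => [|[] s IHs] //=; [rewrite implybT|rewrite IHs]. Qed.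

(** Along a run of [true] the values have period two, so between two zeros a nonzero solution 1, 0,
    ..., 1 fits exactly when the run is odd. Swapping [u] and [w] tracks the run parity, hence the
    simultaneous induction. *)
Lemma solvable_untwisted x2 x2' s :
  ((solvable false false x2 s false false false
    || solvable false false x2' s false true true) = ~~ even_runs false s) *
  ((solvable false false x2 s false false false
    || solvable false false x2' s true false true) = ~~ even_runs true s).
Proof.
have zero y : forall t, solvable false false y t false false true.
  by elim=> [|[] t IHt] //=; rewrite IHt.
elim: s x2 x2' => [|[] s IHs] x2 x2' //=; first by rewrite !IHs.
by rewrite orbF IHs zero !orbT.
Qed.

(** The situation after an odd first run: [x1] is zero and [x2 = t] is free. An odd last run ends
    with [w] zero, and [u = t = 1] closes the cycle. *)
Lemma solvable_even_runs s :
  (some2 (fun t v => solvable true false t s false v (t || v))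
     = ~~ even_runs false s) *
  (some2 (fun t v => solvable true false t s v false (t || v))
     = ~~ even_runs true s).
Proof.
rewrite /some2 /=; elim: s => [|[] s IHs] //=; first by rewrite !IHs.
by rewrite !orbF -orbA IHs solvable_zero !orbT.
Qed.

(** The situation after an even first run: [x2] is zero and [x1 = y]. Closing up demands
    [u = w = y], while one of [u], [w] is zero; hence the last run admits only zeros, whatever its
    parity. *)
Lemma solvable_even_runs_but_last s :
  (some2 (fun y v => solvable true y false s false v (y || v))
     = ~~ even_runs_but_last false s) *
  (some2 (fun y v => solvable true y false s v false (y || v))
     = ~~ even_runs_but_last true s).
Proof.
rewrite /some2 /=; elim: s => [|[] s IHs] //=; first by rewrite !IHs.
by rewrite !orbF -orbA IHs solvable_zero !orbT.
Qed.

(** The first [false] forces [x2] to vanish after an even run and [x1] after an odd one, which leads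
    to the two preceding cases. *)
Lemma solvable_even_runs_but_end s :
  (some2 (fun x1 x2 => solvable true x1 x2 s x1 x2 (x1 || x2))
     = ~~ even_runs_but_end false s) *
  (some2 (fun x1 x2 => solvable true x1 x2 s x2 x1 (x1 || x2))
     = ~~ even_runs_but_end true s).
Proof.
elim: s => [|[] s [IHf IHt]] //.
split; first rewrite -[RHS](solvable_even_runs_but_last s).1.
  by rewrite /some2 /= !orbF -!orbA.
rewrite -[RHS](solvable_even_runs s).1.
by rewrite /some2 /= !orbF -!orbA.
Qed.

Lemma accepted_solvable b1 s :
  accepted b1 s =
  ~~ some2 (fun x1 x2 => (x1 ==> b1) && solvable b1 x1 x2 s x1 x2 (x1 || x2)).
Proof.
apply: negb_inj; rewrite negbK /accepted.
case: b1; last by rewrite /some2 /= orbF -(solvable_untwisted false true s).1.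
rewrite -(solvable_even_runs_but_end s).1 /some2 /=.
by [].
Qed.

End Automaton.

(** * Enumeration of binary words *)

Fixpoint words m : seq (seq bool) :=
  if m is m'.+1 then
    [seq true :: s | s <- words m'] ++ [seq false :: s | s <- words m']
  else [:: [::]].

Lemma mem_words m s : (s \in words m) = (size s == m).
Proof.
have inj_cons b : injective (cons b : seq bool -> seq bool) by move=> ? ? [].
elim: m s => [|m IHm] [|b s] //=; rewrite mem_cat.
  by apply/negP => /orP[] /mapP[].
have cross b' : b != b' -> (b :: s \in [seq b' :: t | t <- words m]) = false.
  by move=> nb; apply/negP => /mapP[t _ [E]]; rewrite E eqxx in nb.
rewrite eqSS -IHm; case: b cross => cross.
  by rewrite (mem_map (@inj_cons true)) cross ?orbF.
by rewrite (mem_map (@inj_cons false)) cross.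
Qed.

Lemma words_uniq m : uniq (words m).
Proof.
elim: m => [|m IHm] //=; rewrite cat_uniq !map_inj_uniq ?IHm /= ?andbT;
  try by move=> ? ? [].
by apply/hasPn => s /mapP[t _ ->]; apply/negP => /mapP[].
Qed.

Lemma count_words (P : pred (seq bool)) m :
  count P (words m.+1) =
  count (fun s => P (true :: s)) (words m) +
  count (fun s => P (false :: s)) (words m).
Proof. by rewrite /= count_cat !count_map. Qed.

(** * Quasi-trees of the twisted bouquet as accepted words *)

Section QuasiTreesOfW1.
Variables (n : nat) (n3 : 3 <= n).
Implicit Types F X : {set 'I_n.+1}.

Definition word F := [seq (inord k \in F : bool) | k <- iota 2 n.-1].

(** The cycle is cut open at vertex 1: the word covers the vertices 2 to [n], and index [n.+1]
    stands for vertex 1 again. *)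
Lemma quasi_tree_W1 F : F \subset edges (W1 n3) ->
  quasi_tree (spanning_sub (W1 n3) F) = accepted (inord 1 \in F) (word F).
Proof.
have [n_gt0 n_gt1] : 0 < n /\ 1 < n by lia.
have neq1n : (1 == n) = false by lia.
move=> FG; rewrite accepted_solvable.
pose b k : bool := inord k \in F.
have n1E : 2 + n.-1 = n.+1 by lia.
apply/(quasi_tree_subP FG)/negP
  => [ker0 /some2P[x1 [x2 /andP[x1b sol]]] | nsol X XF kerX].
  move: sol => /(@solvableP _ _ _ b); case=> //; try by case: (x1); case: (x2).
  move=> x [/= X1 X2 rowx [endx endb] nzx]; rewrite n1E /= in rowx endx nzx.
  rewrite (_ : 1 + n.-1 = n) in endb; last by lia.
  pose X : {set 'I_n.+1} := [set e : 'I_n.+1 | (0 < e) && x e].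
  have inX k : 0 < k <= n -> (inord k \in X) = x k.
    by move=> /andP[k_gt0 k_le]; rewrite inE inordK // k_gt0.
  have XF : X \subset F.
    apply/subsetP => e; rewrite inE => /andP[e_gt0 xe].
    have [e1|e_neq1] := eqVneq (e : nat) 1.
      by move: x1b; rewrite -X1 -e1 xe /= inord_val.
    have : row b x e.
      by apply: rowx; rewrite ltn_ord andbT; case: (nat_of_ord e) e_gt0 e_neq1 => [|[]].
    by rewrite /row /b inord_val xe; case: (e \in F).
  have X0 : X = set0.
    apply: ker0 => //; apply/in_kernel_W1 => // i i_bd bi.
    rewrite !inX ?cpred_bounds ?csucc_bounds // /cpred /csucc.
    have [Ei|i_neq1] := eqVneq i 1.
      by rewrite Ei neq1n /= X1 X2; apply: endb; rewrite -Ei.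
    have ri : row b x i.
      by apply: rowx; rewrite ltn_neqAle eq_sym i_neq1 ltnS.
    move: ri; rewrite /row /b bi => /eqP ->.
    by have [->|_] := eqVneq i n; rewrite ?endx ?X1 addbb.
  have nX k : 0 < k <= n -> x k = false by move=> /inX <-; rewrite X0 inE.
  have xF1 : x1 = false by rewrite -X1 nX.
  have xF2 : x2 = false by rewrite -X2 nX.
  move: nzx; rewrite xF1 xF2 => -[//|[j /andP[j2]]].
  rewrite leq_eqVlt => /predU1P[->|jn]; first by rewrite endx xF1.
  by rewrite nX //; apply/andP; split; [apply: ltn_trans j2|rewrite -ltnS].
apply/setP => e; rewrite inE; apply/negP => eX; case: nsol.
(* The wrap is explicit, since [inord n.+1] would be the label 0. *)
pose x k : bool := inord (if k == n.+1 then 1 else k) \in X.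
have xE k : k <= n -> x k = (inord k \in X) by rewrite /x; case: eqP => //; lia.
have [x1E x2E] : x 1 = (inord 1 \in X) /\ x 2 = (inord 2 \in X).
  by split; apply: xE.
have rows := (in_kernel_W1 X FG).1 kerX.
have e_gt0 : 0 < e by have := subsetP FG _ (subsetP XF _ eX); rewrite inE.
apply/some2P; exists (x 1), (x 2); apply/andP; split.
  by rewrite x1E; apply/implyP; exact: (subsetP XF).
apply/(@solvableP _ _ _ b) => //; try by move=> ->; rewrite ?orbT.
exists x; rewrite n1E; split=> //.
- move=> j /andP[j_gt1 j_le]; have j_gt0 := ltnW j_gt1.
  rewrite /row; case: ifP => [bj|/negP nbj]; last first.
    rewrite xE //.
    by apply/negP => /(subsetP XF).
  have j_bd' : 0 < j <= n by rewrite j_gt0.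
  have := rows j j_bd' bj; rewrite /cpred /csucc.
  rewrite gtn_eqF // xE ?(leq_trans (leq_pred j)) //.
  by rewrite /x eqSS /=; case: (_ \in X); case: (_ \in X).
- have -> : x n.+1 = x 1 by rewrite x1E /x eqxx.
  split=> // b1T; have := rows 1 _ b1T; rewrite /cpred /csucc /=.
  by rewrite neq1n xE // x1E x2E; apply.
- have xe : x e by rewrite xE ?inord_val // -ltnS.
  have [e2|] := leqP (e : nat) 2; last first.
    by move=> e2; right; exists (e : nat) => //; rewrite e2 ltnW.
  by left; move: xe e_gt0 e2; case: (nat_of_ord e) => [|[|[|]]] // ->; rewrite ?orbT.
Qed.

(** An edge set is encoded by its membership word on 1, ..., n; the first letter selects the
    automaton for the rest. *)
Lemma kappa_W1 :
  kappa (W1 n3) =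
  count (accepted true) (words n.-1) + count (accepted false) (words n.-1).
Proof.
have nE : n = n.-1.+1 by lia.
pose bits (F : {set 'I_n.+1}) : seq bool := [seq inord k \in F | k <- iota 1 n].
pose Q s := accepted (head false s) (behead s).
have bitsE F : bits F = (inord 1 \in F) :: word F.
  by rewrite /bits (_ : iota 1 n = 1 :: iota 2 n.-1) // {1}nE.
rewrite -(count_words Q) -nE /kappa -size_filter cardE.
set A := enum _; rewrite -(size_map bits A); apply: perm_size.
have bits_mem F (e : 'I_n.+1) : 0 < e -> (e \in F) = nth false (bits F) e.-1.
  move=> e_gt0; have e_lt : e.-1 < n by rewrite prednK // -ltnS.
  by rewrite (nth_map 0) ?size_iota // nth_iota // add1n prednK // inord_val.
apply: uniq_perm.
- rewrite map_inj_in_uniq ?enum_uniq // => F F'; rewrite !mem_enum !inE.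
  move=> /andP[/subsetP FG _] /andP[/subsetP FG' _] E; apply/setP => e.
  have [e0|e_gt0] := posnP e; last by rewrite !bits_mem // E.
  by apply/idP/idP => [/FG|/FG']; rewrite inE e0.
- by rewrite filter_uniq // words_uniq.
move=> s; rewrite mem_filter mem_words; apply/mapP/andP => [[F]|[Qs /eqP ss]].
  rewrite mem_enum inE => /andP[FG qF] ->; rewrite size_map size_iota; split=> //.
  by rewrite bitsE /Q /= -(quasi_tree_W1 FG).
pose F := [set e : 'I_n.+1 | (0 < e) && nth false s e.-1].
have FG : F \subset edges (W1 n3).
  by apply/subsetP => e; rewrite !inE => /andP[].
have sE : bits F = s.
  apply: (@eq_from_nth _ false); rewrite size_map size_iota // => k kn.
  by rewrite (nth_map 0) ?size_iota // nth_iota // add1n inE inordK.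
exists F; rewrite ?sE // mem_enum inE FG (quasi_tree_W1 FG) /=.
by move: Qs; rewrite -sE bitsE.
Qed.

End QuasiTreesOfW1.

(** * Fibonacci counts of the accepted words *)

(** The even state allows both letters, the odd state only [true]: this is the Fibonacci
    recurrence. *)
Lemma count_even_runs m :
  (count (even_runs false) (words m) = fib m.+1) *
  (count (even_runs true) (words m) = fib m).
Proof.
elim: m => [|m [IHf IHt]] //; rewrite !count_words /= IHf IHt.
by rewrite [count (fun _ => false) _]count_pred0 addn0 addnC.
Qed.

(** The recurrence is the same, but both states accept the empty word, which shifts the index by
    one. *)
Lemma count_even_runs_but_last m :
  (count (even_runs_but_last false) (words m) = fib m.+2) *
  (count (even_runs_but_last true) (words m) = fib m.+1).
Proof.
elim: m => [|m [IHf IHt]] //; rewrite !count_words /= IHf IHt.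
by rewrite [count (fun _ => false) _]count_pred0 addn0 addnC.
Qed.

(** The letter [true] exchanges the two states and [false] exits to the earlier automata. The
    alternating correction by 0 or 2 stands on the left to avoid truncated subtraction. *)
Lemma count_even_runs_but_end m :
  (count (even_runs_but_end false) (words m) + (odd m).*2
     = fib m.+1 + (fib m).*2) *
  (count (even_runs_but_end true) (words m) + (~~ odd m).*2
     = (fib m.+1).*2).
Proof.
elim: m => [|m [IHf IHt]] //; rewrite !count_words /=.
rewrite (count_even_runs m).1 (count_even_runs_but_last m).1 negbK /= -/(fib m.+1).
move: IHf IHt; move: (count _ _) (count _ _) => c d.
by move: (fib m.+1) (fib m) (odd m) => f g [] /=; split; lia.
Qed.

Local Open Scope ring_scope.

Theorem theorem5p5 (n : nat) (hn : (3 <= n)%N) :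
  (kappa (W1 hn))%:Z = 2 * (fib n.+1)%:Z - 1 + (-1) ^+ n.+1.
Proof.
rewrite kappa_W1; case: n hn => // m _.
have := (count_even_runs_but_end m).1; have := (count_even_runs m).1.
rewrite -[accepted true]/(even_runs_but_end false).
rewrite -[accepted false]/(even_runs false) -[m.+1.-1]/m.
have -> : fib m.+2 = (fib m.+1 + fib m)%N by [].
(* With [n = m.+1], the correction [(odd m).*2] equals 1 - (-1)^(n+1). *)
rewrite -GRing.signr_odd [odd m.+2]/= negbK.
move: (count _ _) (count _ _) (fib m.+1) (fib m) => c d f g ->.
by case: (odd m); rewrite ?GRing.expr0 ?GRing.expr1 /=; lia.
Qed.
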